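(* Let $M\ge 1$, let $T>0$, and let $k_B>0$ be Boltzmann's constant. For the cyclically closed $2\times2\times M$ lattice model described in the context, with arbitrary real couplings $(J_\alpha)_{\alpha\in\Phi}$, let $Z_{M}(T)=\sum_{\sigma}\exp(-\mathcal H(\sigma)/(k_BT))$, where the sum runs over all $\sigma\in\{-1,1\}^{4M}$. Let $\lambda_{\max}(T)$ be the largest real root of the fourth-degree characteristic equation $\det(\lambda I-\tau)=0$ of the $4\times4$ matrix $\tau=\tau(T)$ defined in the context. Then, in the thermodynamic limit, the free energy per site $f(T)=-k_BT\lim_{M\to\infty}\frac{1}{4M}\ln Z_M(T)$ satisfies $$f(T)=-\frac{k_BT}{4}\ln\lambda_{\max}(T),$$ the internal energy per site $u(T)=-T^2\frac{\partial}{\partial T}\big[f(T)/T\big]$ equals $$u(T)=k_BT^2\frac{\partial}{\partial T}\Big[\tfrac14\ln\lambda_{\max}(T)\Big],$$ and the heat capacity per site $C(T)=\frac{\partial}{\partial T}u(T)$ equals $$C(T)=2k_BT\frac{\partial}{\partial T}\Big[\tfrac14\ln\lambda_{\max}(T)\Big]+k_BT^2\frac{\partial^2}{\partial T^2}\Big[\tfrac14\ln\lambda_{\max}(T)\Big].$$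
   Context: Lattice: sites $t_i^m$, $i\in\{0,1,2,3\}$, $m\in\{0,\dots,M-1\}$, with cyclic closure $t_i^M\equiv t_i^0$ (so $N=4M$ sites); each site carries a spin $\sigma_{t_i^m}=\sigma_i^m\in\{-1,1\}$. For a set $\Omega$ of sites, $\sigma_\Omega=\prod_{t\in\Omega}\sigma_t$. For fixed $m$ write $a_i=t_i^m$, $b_i=t_i^{m+1}$, and let $C_m=\{a_0,a_1,a_2,a_3,b_0,b_1,b_2,b_3\}$ (a unit cube). Let $\rho$ be the rotation of $C_m$ given by $\rho(a_i)=a_{i+1 \bmod 4}$, $\rho(b_i)=b_{i+1\bmod 4}$. Generating supports $\Phi=\Phi_2\cup\Phi_4\cup\Phi_6\cup\Phi_8$ (all subsets of $C_m$): $\Phi_2=\{\{a_0,a_1\},\{a_0,a_2\},\{b_0,b_1\},\{b_0,b_2\},\{a_0,b_0\},\{a_0,b_1\},\{a_0,b_2\},\{a_0,b_3\}\}$; $\Phi_4$ consists of the 22 sets $\{a_0,b_0,b_1,b_2\}$, $\{a_0,b_1,b_2,b_3\}$, $\{a_0,b_2,b_3,b_0\}$, $\{a_0,b_3,b_0,b_1\}$, $\{a_0,a_1,b_0,b_1\}$, $\{a_0,a_1,b_1,b_2\}$, $\{a_0,a_1,b_2,b_3\}$, $\{a_0,a_1,b_3,b_0\}$, $\{a_0,a_1,b_0,b_2\}$, $\{a_0,a_1,b_1,b_3\}$, $\{a_0,a_2,b_0,b_1\}$, $\{a_0,a_2,b_1,b_2\}$, $\{a_0,a_2,b_2,b_3\}$,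 $\{a_0,a_2,b_3,b_0\}$, $\{a_0,a_2,b_0,b_2\}$, $\{a_0,a_2,b_1,b_3\}$, $\{a_0,a_1,a_2,b_0\}$, $\{a_0,a_1,a_2,b_1\}$, $\{a_0,a_1,a_2,b_2\}$, $\{a_0,a_1,a_2,b_3\}$, $\{a_0,a_1,a_2,a_3\}$, $\{b_0,b_1,b_2,b_3\}$; $\Phi_6=\{C_m\setminus\beta:\beta\in\Phi_2\}$; $\Phi_8=\{C_m\}$. Each $\alpha\in\Phi$ carries a real coupling $J_\alpha$, the same for all $m$. The cube Hamiltonian is $\mathcal H^m=-\sum_{\alpha\in\Phi}J_\alpha\sum_{r=0}^{3}\sigma_{\rho^r(\alpha)}$ and the total Hamiltonian is $\mathcal H=\sum_{m=0}^{M-1}\mathcal H^m$. Transfer matrix: index a layer state $(s_0,s_1,s_2,s_3)\in\{-1,1\}^4$ by $k=1+\sum_{i=0}^3 2^i(1-s_i)/2\in\{1,\dots,16\}$. The $16\times16$ matrix $\theta$ has entries $\theta_{k,l}=\exp(-\mathcal H^m/(k_BT))$, where $\mathcal H^m$ is evaluated with $(\sigma_0^m,\dots,\sigma_3^m)$ the state of index $k$ and $(\sigma_0^{m+1},\dots,\sigma_3^{m+1})$ the state of index $l$ (this does not depend on $m$). Let $(r_1,r_2,r_3,r_4)=(1,2,4,6)$ and $G_1=\{1,16\}$, $G_2=\{2,3,5,8,9,12,14,15\}$, $G_3=\{4,7,10,13\}$, $G_4=\{6,11\}$. The $4\times4$ matrix $\tau$ has entries $\tau_{i,j}=\sum_{l\in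 G_j}\theta_{r_i,l}$. *)

(* Defs.v *)
From HB Require Import structures.
From mathcomp Require Import all_boot all_order all_algebra.
From mathcomp Require Import all_classical all_reals all_analysis.
Set Implicit Arguments. Unset Strict Implicit. Unset Printing Implicit Defensive.
Import Order.TTheory GRing.Theory Num.Theory.
Import numFieldNormedType.Exports.
Local Open Scope ring_scope.

(* A site of the unit cube C_m is encoded as a pair (d, i) of naturals:
   (0, i) = a_i = t_i^m  and  (1, i) = b_i = t_i^{m+1},  i in {0,1,2,3}. *)
Definition a (i : nat) : nat * nat := (0%N, i).
Definition b (i : nat) : nat * nat := (1%N, i).

Definition cube_sites : seq (nat * nat) :=
  [:: a 0; a 1; a 2; a 3; b 0; b 1; b 2; b 3].

Definition Phi2 : seq (seq (nat * nat)) :=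
  [:: [:: a 0; a 1]; [:: a 0; a 2]; [:: b 0; b 1]; [:: b 0; b 2];
      [:: a 0; b 0]; [:: a 0; b 1]; [:: a 0; b 2]; [:: a 0; b 3]].

Definition Phi4 : seq (seq (nat * nat)) :=
  [:: [:: a 0; b 0; b 1; b 2]; [:: a 0; b 1; b 2; b 3];
      [:: a 0; b 2; b 3; b 0]; [:: a 0; b 3; b 0; b 1];
      [:: a 0; a 1; b 0; b 1]; [:: a 0; a 1; b 1; b 2];
      [:: a 0; a 1; b 2; b 3]; [:: a 0; a 1; b 3; b 0];
      [:: a 0; a 1; b 0; b 2]; [:: a 0; a 1; b 1; b 3];
      [:: a 0; a 2; b 0; b 1]; [:: a 0; a 2; b 1; b 2];
      [:: a 0; a 2; b 2; b 3]; [:: a 0; a 2; b 3; b 0];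
      [:: a 0; a 2; b 0; b 2]; [:: a 0; a 2; b 1; b 3];
      [:: a 0; a 1; a 2; b 0]; [:: a 0; a 1; a 2; b 1];
      [:: a 0; a 1; a 2; b 2]; [:: a 0; a 1; a 2; b 3];
      [:: a 0; a 1; a 2; a 3]; [:: b 0; b 1; b 2; b 3]].

Definition Phi6 : seq (seq (nat * nat)) :=
  [seq [seq p <- cube_sites | p \notin beta] | beta <- Phi2].

Definition Phi8 : seq (seq (nat * nat)) := [:: cube_sites].

Definition Phi : seq (seq (nat * nat)) := Phi2 ++ Phi4 ++ Phi6 ++ Phi8.

Section Model.
Variable R : realType.

Definition spin (x : bool) : R := if x then -1 else 1.

(* sigma_{rho^r(alpha)} for the cube whose lower layer (a_0..a_3) has
   configuration sa and upper layer (b_0..b_3) has configuration sb;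
   rho^r maps a_i to a_{(i+r) mod 4} and b_i to b_{(i+r) mod 4}. *)
Definition rot_prod (sa sb : nat -> bool) (alpha : seq (nat * nat)) (r : nat) : R :=
  \prod_(p <- alpha)
     spin (if p.1 == 0%N then sa ((p.2 + r) %% 4)%N else sb ((p.2 + r) %% 4)%N).

Definition Hcube (J : 'I_(size Phi) -> R) (sa sb : nat -> bool) : R :=
  - \sum_(j < size Phi) J j * \sum_(r < 4) rot_prod sa sb (nth [::] Phi j) r.

Definition layer M (sigma : {ffun 'I_M -> {ffun 'I_4 -> bool}}) (m : 'I_M) : nat -> bool :=
  fun i => sigma m (inord i).

(* total Hamiltonian with cyclic closure t_i^M = t_i^0 *)
Definition Hlat (J : 'I_(size Phi) -> R) M (sigma : {ffun 'I_M -> {ffun 'I_4 -> bool}}) : R :=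
  \sum_(m < M) Hcube J (layer sigma m) (layer sigma (ordS m)).

Definition Zpart (kB : R) (J : 'I_(size Phi) -> R) (M : nat) (T : R) : R :=
  \sum_(sigma : {ffun 'I_M -> {ffun 'I_4 -> bool}}) expR (- Hlat J sigma / (kB * T)).

(* layer state of (1-based) index k = 1 + sum_i 2^i (1 - s_i)/2 :
   s_i = -1 (i.e. [true]) iff bit i of k-1 is set *)
Definition state_of_index (k : nat) : nat -> bool := fun i => odd ((k.-1) %/ 2 ^ i).

(* transfer matrix entry theta_{k,l}, 1-based indices k, l in 1..16 *)
Definition theta_entry (kB : R) (J : 'I_(size Phi) -> R) (T : R) (k l : nat) : R :=
  expR (- Hcube J (state_of_index k) (state_of_index l) / (kB * T)).

Definition theta (kB : R) (J : 'I_(size Phi) -> R) (T : R) : 'M[R]_16 :=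
  \matrix_(k < 16, l < 16) theta_entry kB J T k.+1 l.+1.

Definition reps : seq nat := [:: 1; 2; 4; 6]%N.
Definition groups : seq (seq nat) :=
  [:: [:: 1; 16]; [:: 2; 3; 5; 8; 9; 12; 14; 15]; [:: 4; 7; 10; 13]; [:: 6; 11]]%N.

(* tau_{i,j} = sum_{l in G_j} theta_{r_i, l} (i, j 0-based here) *)
Definition tau (kB : R) (J : 'I_(size Phi) -> R) (T : R) : 'M[R]_4 :=
  \matrix_(i < 4, j < 4)
     \sum_(1 <= l < 17 | l \in nth [::] groups j) theta_entry kB J T (nth 0%N reps i) l.

Definition is_largest_real_root (p : {poly R}) (x : R) : Prop :=
  poly.root p x /\ forall y : R, poly.root p y -> y <= x.

Definition free_energy (kB : R) (J : 'I_(size Phi) -> R) (T : R) : R :=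
  - kB * T * limn (fun n : nat => ln (Zpart kB J n.+1 T) / (4 * n.+1)%:R).

Definition internal_energy (kB : R) (J : 'I_(size Phi) -> R) (T : R) : R :=
  - T ^+ 2 * derive1 (fun t : R => free_energy kB J t / t) T.

Definition heat_capacity (kB : R) (J : 'I_(size Phi) -> R) (T : R) : R :=
  derive1 (internal_energy kB J) T.

End Model.

(* Main.v *)
(** The partition function is the cyclic sum of a strictly positive kernel on
    the 16 layer states.  The kernel commutes with the rotation and with the
    global spin flip (all supports have even cardinality), and G_1, ..., G_4
    are the orbits of layer states, so a positive eigenvector of tau lifts to
    one of the kernel and Z_M lies between constant multiples of
    lambda_max ^ (M - 1).  By Perron's theorem lambda_max is a simple root of
    the characteristic polynomial of tau and depends continuously on T; as the
    coefficients of that polynomial are smooth in T > 0, implicit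
    differentiation makes lambda_max twice derivable, and the formulas for the
    energies are then calculus. *)

Require Import Defs.
From HB Require Import structures.
From mathcomp Require Import all_boot all_order all_algebra.
From mathcomp Require Import all_classical all_reals all_analysis.
From mathcomp Require Import ring lra.
Import Order.TTheory GRing.Theory Num.Theory.
Import numFieldNormedType.Exports.
Local Open Scope classical_set_scope.
Local Open Scope ring_scope.

(** * Perron's theorem *)

(** The reciprocal of [1 + \sum_i (f i)^-1] serves instead of a minimum; the summand 1 keeps it
    positive when [I] is empty. *)
Lemma lower_bound_gt0 {R : realType} {I : finType} {f : I -> R} :
  (forall i, 0 < f i) -> exists2 e, 0 < e & forall i, e <= f i.
Proof.
move=> f0; have S0 : 0 < 1 + \sum_i (f i)^-1.
  by rewrite ltr_pwDl ?sumr_ge0// => i _; rewrite invr_ge0 ltW.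
exists (1 + \sum_i (f i)^-1)^-1; first by rewrite invr_gt0.
move=> i; rewrite -[leRHS]invrK lef_pV2 ?posrE ?invr_gt0// (bigD1 i)//=.
rewrite addrCA lerDl addr_ge0// sumr_ge0// => j _.
by rewrite invr_ge0 ltW.
Qed.

Section Perron.
Variables (R : realType) (n : nat) (A : 'M[R]_n.+1).
Hypothesis A_gt0 : forall i j, 0 < A i j.

Let appl (u : 'I_n.+1 -> R) i := \sum_j A i j * u j.

(** The Collatz-Wielandt number of a vector is a minimum of quotients whose denominators may vanish.
    With mu as a second coordinate, its supremum becomes the maximum of a projection. *)
Let subinvariant (p : 'rV[R]_n.+1 * R) :=
  [/\ forall i, 0 <= p.1 ord0 i, \sum_i p.1 ord0 i = 1, 0 <= p.2 &
      forall i, p.2 * p.1 ord0 i <= appl (p.1 ord0) i].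

Let coord_fst_cts i : continuous (fun p : 'rV[R]_n.+1 * R => p.1 ord0 i).
Proof.
move=> p; apply: (@continuous_comp _ _ _ fst (fun v : 'rV[R]_n.+1 => v ord0 i)).
  exact: cvg_fst.
exact: coord_continuous.
Qed.

Let closed_ge0 (T : topologicalType) (h : T -> R) :
  continuous h -> closed [set x | 0 <= h x].
Proof.
move=> hc; apply: (@preimage_closed _ _ h [set x | 0 <= x]); last exact: closed_ge.
by move=> x _; exact: hc.
Qed.

Let subinvariant_bounded p : subinvariant p -> p.2 <= \sum_i \sum_j A i j.
Proof.
move=> [p0 p1 m0 pA]; rewrite -[leLHS]mulr1 -p1 mulr_sumr.
apply: ler_sum => i _; apply: le_trans (pA i) _.
apply: ler_sum => j _; apply: ler_piMr; first exact: ltW.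
rewrite -p1 (bigD1 j)//= lerDl sumr_ge0//.
Qed.

Let subinvariant_compact : compact [set p | subinvariant p].
Proof.
set B := \sum_i \sum_j A i j.
apply: (@subclosed_compact _ _
  ([set v : 'rV[R]_n.+1 | forall i, `[0, 1]%classic (v ord0 i)] `*` `[0, B]%classic)).
- have -> : [set p | subinvariant p] =
     (\bigcap_i [set p : 'rV[R]_n.+1 * R | 0 <= p.1 ord0 i]) `&`
     ([set p : 'rV[R]_n.+1 * R | 0 <= \sum_i p.1 ord0 i - 1] `&`
      ([set p : 'rV[R]_n.+1 * R | 0 <= 1 - \sum_i p.1 ord0 i] `&`
       ([set p : 'rV[R]_n.+1 * R | 0 <= p.2] `&`
        \bigcap_i [set p : 'rV[R]_n.+1 * R | 0 <= appl (p.1 ord0) i - p.2 * p.1 ord0 i]))).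
    apply/seteqP; split=> p /=.
      case=> p0 p1 m0 pA; rewrite p1 subrr.
      split; first by move=> i _; exact: p0.
      split; first by rewrite lexx.
      split; first by rewrite lexx.
      by split => // i _ /=; rewrite subr_ge0.
    case=> p0; rewrite !subr_ge0 => -[p1 [p1' [m0 pA]]]; split => //.
    - by move=> i; exact: p0.
    - by apply/eqP; rewrite eq_le p1 p1'.
    - by move=> i; have := pA i I; rewrite /= subr_ge0.
  have sum_cts (c : 'I_n.+1 -> R) :
      continuous (fun p : 'rV[R]_n.+1 * R => \sum_j c j * p.1 ord0 j).
    apply: continuous_big => [|j _ p]; first exact: add_continuous.
    apply: cvgM; first exact: cvg_cst.
    exact: coord_fst_cts.
  have sum1_cts : continuous (fun p : 'rV[R]_n.+1 * R => \sum_j p.1 ord0 j).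
    by apply: continuous_big => [|j _]; [exact: add_continuous|exact: coord_fst_cts].
  apply: closedI; first by apply: closed_bigI => i _; apply: closed_ge0.
  apply: closedI.
    by apply: closed_ge0 => p; apply: cvgB; [exact: sum1_cts|exact: cvg_cst].
  apply: closedI.
    by apply: closed_ge0 => p; apply: cvgB; [exact: cvg_cst|exact: sum1_cts].
  apply: closedI; first by apply: closed_ge0 => p; exact: cvg_snd.
  apply: closed_bigI => i _; apply: closed_ge0 => p; apply: cvgB.
    exact: sum_cts.
  by apply: cvgM; [exact: cvg_snd|exact: coord_fst_cts].
- apply: compact_setX; last exact: segment_compact.
  by apply: (@rV_compact R _ (fun=> `[0, 1]%classic)) => i; exact: segment_compact.
- move=> p sp; have [p0 p1 m0 pA] := sp; split => /=.
    move=> i; rewrite in_itv/= p0/= -p1 (bigD1 i)//= lerDl sumr_ge0//.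
  by rewrite in_itv/= m0; exact: subinvariant_bounded.
Qed.

Let appl_gt0 (u : 'I_n.+1 -> R) i :
  (forall j, 0 <= u j) -> 0 < \sum_j u j -> 0 < appl u i.
Proof.
move=> u0 us; rewrite lt_neqAle sumr_ge0 ?andbT; last first.
  by move=> j _; rewrite mulr_ge0 ?u0 // ltW.
apply/eqP => /esym/eqP; rewrite psumr_eq0; last by move=> j _; rewrite mulr_ge0 ?u0 // ltW.
move=> /allP uA; move: us; rewrite big1 ?ltxx// => j _.
have /uA := mem_index_enum j.
by rewrite mulf_eq0 gt_eqF//= => /eqP.
Qed.

Let subinvariant_normalize (u : 'I_n.+1 -> R) mu : 0 <= mu ->
  (forall j, 0 <= u j) -> 0 < \sum_j u j -> (forall i, mu * u i <= appl u i) ->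
  subinvariant (\row_i (u i / \sum_j u j), mu).
Proof.
move=> mu0 u0 us uA; split => //=.
- by move=> i; rewrite mxE divr_ge0// ltW.
- under eq_bigr do rewrite mxE.
  by rewrite -mulr_suml divff// gt_eqF.
- move=> i; rewrite /appl /=; under [leRHS]eq_bigr do rewrite mxE mulrA.
  by rewrite mxE -mulr_suml mulrA ler_pM2r ?invr_gt0.
Qed.

(* Maximise mu over the compact set of normalised subinvariant pairs
   mu u <= A u; at a maximiser equality must hold, since otherwise
   A u would satisfy the strict inequality in every coordinate. *)
Theorem Perron : exists lam : R, exists v : 'I_n.+1 -> R,
  [/\ 0 < lam, forall i, 0 < v i, forall i, \sum_j A i j * v j = lam * v i &
      forall mu (u : 'I_n.+1 -> R), (forall j, 0 <= u j) -> 0 < \sum_j u j ->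
        (forall i, mu * u i <= \sum_j A i j * u j) -> mu <= lam].
Proof.
have one_gt0 : 0 < \sum_(i < n.+1) (1 : R).
  by rewrite sumr_const card_ord ltr0n.
have ne : [set p | subinvariant p] !=set0.
  exists (\row_i (1 / \sum_(j < n.+1) 1), 0); apply: (subinvariant_normalize (fun=> 1)) => //.
  by move=> i; rewrite mul0r ltW// appl_gt0.
have sc : {within [set p | subinvariant p], continuous (fun p : 'rV[R]_n.+1 * R => p.2)}.
  by apply: continuous_subspaceT => p; exact: cvg_snd.
have [[v lam]] := compact_EVT_max ne subinvariant_compact sc.
rewrite inE => -[/= v0 v1 lam0 vA] lam_max.
have lam_ge mu (u : 'I_n.+1 -> R) : (forall j, 0 <= u j) -> 0 < \sum_j u j ->
    (forall i, mu * u i <= appl u i) -> mu <= lam.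
  move=> u0 us uA; have [mu0|/ltW mu0] := leP 0 mu; last exact: le_trans lam0.
  have /lam_max : (\row_i (u i / \sum_j u j), mu) \in [set p | subinvariant p].
    by rewrite inE; exact: subinvariant_normalize.
  by [].
have w0 i : 0 < appl (v ord0) i by rewrite appl_gt0// v1.
have vE i : appl (v ord0) i = lam * v ord0 i.
  apply/eqP; rewrite eq_le vA andbT leNgt; apply/negP => lt_i.
  set w := appl (v ord0) in w0 lt_i.
  (* [A w - lam w = A (w - lam v)], and [w - lam v] is nonnegative and positive at [i]. Dividing by
     [w k] gives the amount by which [lam] can be raised in row [k]. *)
  have gap k : 0 < (appl w k - lam * w k) / w k.
    rewrite divr_gt0//.
    have -> : appl w k - lam * w k = appl (fun j => w j - lam * v ord0 j) k.
      rewrite /appl; under [RHS]eq_bigr do rewrite mulrBr.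
      rewrite sumrB; congr (_ - _); rewrite /w /appl mulr_sumr.
      by apply: eq_bigr => j _; rewrite mulrCA.
    apply: appl_gt0 => [j|]; first by rewrite subr_ge0.
    rewrite (bigD1 i)//= ltr_wpDr ?subr_gt0//.
    by rewrite sumr_ge0// => j _; rewrite subr_ge0.
  have [e e0 ele] := lower_bound_gt0 gap.
  suff : lam + e <= lam by rewrite leNgt ltrDl e0.
  apply: (lam_ge _ w) => [j||k]; first exact: ltW.
    rewrite (bigD1 i)//= ltr_wpDr// sumr_ge0// => j _; exact: ltW.
  by have := ele k; rewrite ler_pdivlMr// lerBrDl -mulrDl.
have lamv i : 0 < lam * v ord0 i by rewrite -vE.
have lam_gt0 : 0 < lam.
  by rewrite lt0r lam0 andbT; apply: contraTneq (lamv ord0) => ->; rewrite mul0r ltxx.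
exists lam, (v ord0); split => // i.
by move: (lamv i); rewrite pmulr_rgt0.
Qed.

End Perron.

(** * Positive eigenvectors and simple roots of the characteristic polynomial *)

Section PositiveEigenvector.
Variables (R : realType) (n : nat) (A : 'M[R]_n.+1) (v : 'I_n.+1 -> R).
Hypotheses (A_gt0 : forall i j, 0 < A i j) (v_gt0 : forall i, 0 < v i).

(** Take a left eigenvector [u] for [y] and pair [|u|] with [v]: the triangle inequality gives
    [|y| (|u| v) <= |u| A v <= mu (|u| v)], and [|u| v > 0]. *)
Lemma root_char_poly_le mu y : (forall i, \sum_j A i j * v j <= mu * v i) ->
  root (char_poly A) y -> y <= mu.
Proof.
move=> Av; rewrite -eigenvalue_root_char => /eigenvalueP[u uA u0].
have uAE j : y * u ord0 j = \sum_i u ord0 i * A i j.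
  by have /matrixP/(_ ord0 j) := uA; rewrite !mxE => <-.
have s_gt0 : 0 < \sum_j `|u ord0 j| * v j.
  have [j uj] : exists j, u ord0 j != 0.
    apply/existsP; apply: contra_neqT u0; rewrite negb_exists => /forallP uz.
    by apply/rowP => j; rewrite mxE; apply/eqP; rewrite -[_ == _]negbK.
  rewrite (bigD1 j)//= ltr_pwDl ?mulr_gt0 ?normr_gt0//.
  by rewrite sumr_ge0// => i _; rewrite mulr_ge0// ltW.
apply: le_trans (ler_norm y) _; rewrite -(ler_pM2r s_gt0) !mulr_sumr.
apply: (@le_trans _ _ (\sum_j \sum_i `|u ord0 i| * (A i j * v j))).
  apply: ler_sum => j _; rewrite mulrA -normrM uAE.
  under [leRHS]eq_bigr do rewrite mulrA.
  rewrite -mulr_suml ler_pM2r//; apply: le_trans (ler_norm_sum _ _ _) _.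
  by apply: ler_sum => i _; rewrite normrM (gtr0_norm (A_gt0 i j)).
rewrite exchange_big/=; apply: ler_sum => i _.
by rewrite -mulr_sumr mulrCA ler_wpM2l.
Qed.

Variable lam : R.
Hypothesis Av : forall i, \sum_j A i j * v j = lam * v i.

Let deflated : 'M[{poly R}]_n.+1 :=
  \matrix_(i, j) if j == ord0 then (v i)%:P else char_poly_mx A i j.

(* Column operations with the eigenvector turn the first column of
   X - A into (X - lam) v. *)
Let char_poly_deflated :
  (v ord0)%:P * char_poly A = \det deflated * ('X - lam%:P).
Proof.
(* [E] is lower triangular with determinant [v ord0], and [(X - A) E] equals [deflated] times the
   diagonal matrix of [d]. *)
pose E : 'M[{poly R}]_n.+1 :=
  \matrix_(i, j) if j == ord0 then (v i)%:P else (i == j)%:R.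
pose d : 'rV[{poly R}]_n.+1 := \row_j if j == ord0 then 'X - lam%:P else 1.
have dE : \det E = (v ord0)%:P.
  rewrite det_trig; last first.
    apply/is_trig_mxP => i j ij; rewrite mxE; case: eqP => [j0|_].
      by move: ij; rewrite j0.
    by rewrite (_ : (i == j) = false)//; apply/negbTE; rewrite -val_eqE neq_ltn ij.
  rewrite big_ord_recl mxE eqxx big1 ?mulr1// => i _.
  by rewrite mxE eqxx.
have dd : \det (diag_mx d) = 'X - lam%:P.
  rewrite det_diag big_ord_recl mxE eqxx big1 ?mulr1// => i _.
  by rewrite mxE.
rewrite mulrC -dE -dd /char_poly -!det_mulmx; congr (\det _).
apply/matrixP => i j; rewrite mul_mx_diag !mxE; case: (eqVneq j ord0) => [->|j0].
  under eq_bigr do rewrite !mxE eqxx mulrBl.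
  rewrite sumrB (bigD1 i)//= eqxx mulr1n big1 => [|k ki]; last first.
    by rewrite eq_sym (negbTE ki) mulr0n mul0r.
  under eq_bigr do rewrite -polyCM.
  by rewrite addr0 -rmorph_sum/= Av polyCM -mulrBl mulrC.
rewrite (bigD1 j)//= !mxE (negbTE j0) eqxx mulr1 big1 ?addr0 ?mulr1// => k kj.
by rewrite !mxE (negbTE j0) (negbTE kj) mulr0.
Qed.

Lemma root_char_poly_eigenvector : root (char_poly A) lam.
Proof.
have := congr1 (horner^~ lam) char_poly_deflated.
rewrite !hornerE subrr mulr0 => /eqP.
by rewrite mulf_eq0 (gt_eqF (v_gt0 _)).
Qed.

(** A nonzero [u] orthogonal to the positive [v] takes both signs, so the triangle inequality for
    [u A] is strict in every column. Pairing [lam |u| < |u| A] with [v] contradicts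
    [A v = lam v]. *)
Let left_eigenvector_not_orthogonal (u : 'I_n.+1 -> R) :
  (exists i, u i != 0) -> (forall j, \sum_i u i * A i j = lam * u j) ->
  \sum_i u i * v i != 0.
Proof.
move=> [k uk] uA; apply/eqP => uv.
(* Equality would force [w = |w|], and a nonnegative [w] orthogonal to [v] vanishes. Applied below
   to both [u] and [- u]. *)
have gap (w : 'I_n.+1 -> R) : w k != 0 -> \sum_i w i * v i = 0 ->
    forall j, \sum_i w i * A i j < \sum_i `|w i| * A i j.
  move=> wk wv j; rewrite -subr_gt0 -sumrB lt_neqAle eq_sym andbC.
  have ge0 i : 0 <= `|w i| * A i j - w i * A i j.
    by rewrite -mulrBl mulr_ge0 ?subr_ge0 ?ler_norm// ltW.
  rewrite sumr_ge0//=; apply: contraNN wk; rewrite psumr_eq0// => /allP wz.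
  have w_ge0 i : 0 <= w i.
    have /wz := mem_index_enum i.
    by rewrite -mulrBl mulf_eq0 (gt_eqF (A_gt0 _ _)) orbF subr_eq0 => /eqP <-.
  move/eqP: wv; rewrite psumr_eq0; last first.
    by move=> i _; rewrite mulr_ge0// ltW.
  by move=> /allP/(_ k (mem_index_enum k)); rewrite mulf_eq0 (gt_eqF (v_gt0 _)) orbF.
have lt_norm j : lam * `|u j| < \sum_i `|u i| * A i j.
  have h1 := gap u uk uv j; rewrite uA in h1.
  have := gap (fun i => - u i).
  rewrite oppr_eq0 => /(_ uk).
  under eq_bigr do rewrite mulNr.
  rewrite sumrN uv oppr0 => /(_ erefl j).
  under eq_bigr do rewrite mulNr.
  under [X in _ < X]eq_bigr do rewrite normrN.
  rewrite sumrN uA => h2.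
  by case: (ger0P (u j)) => _; rewrite ?mulrN.
have : \sum_j lam * `|u j| * v j < \sum_j (\sum_i `|u i| * A i j) * v j.
  by apply: ltr_sum => [|j _]; [apply/hasP; exists ord0; rewrite ?mem_index_enum|rewrite ltr_pM2r].
apply/negP; rewrite -leNgt.
under eq_bigr do rewrite mulr_suml.
rewrite exchange_big/=; apply: ler_sum => i _.
under eq_bigr do rewrite -mulrA.
by rewrite -mulr_sumr Av mulrCA mulrA.
Qed.

(** Up to the factor [v ord0], the derivative at [lam] is the determinant of [deflated] there. A row
    vector killing that matrix is orthogonal to [v] by its first column and a left eigenvector by
    the others, which is impossible. *)
Lemma char_poly_deriv_eigenvector_neq0 : (char_poly A)^`().[lam] != 0.
Proof.
have : (v ord0) * (char_poly A)^`().[lam] = (\det deflated).[lam].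
  have := congr1 (fun p => p^`().[lam]) char_poly_deflated.
  by rewrite !derivM derivXsubC derivC mul0r add0r !hornerE subrr mulr0 add0r.
apply: contra_eq_neq => ->; rewrite mulr0 eq_sym.
rewrite -[_.[lam]]/(horner_eval lam _) -det_map_mx.
apply/det0P => -[u u0 uF].
have uFj j : \sum_i u ord0 i * (if j == ord0 then v i else (i == j)%:R * lam - A i j) = 0.
  have /matrixP/(_ ord0 j) := uF; rewrite [LHS]mxE [RHS]mxE => uFj.
  rewrite -[RHS]uFj; apply: eq_bigr => i _; rewrite !mxE /= /horner_eval.
  case: ifP => _; rewrite !hornerE//.
  by rewrite hornerMn hornerX mulr_natl.
have uv : \sum_i u ord0 i * v i = 0 by have := uFj ord0; rewrite eqxx.
pose c j := lam * u ord0 j - \sum_i u ord0 i * A i j.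
have cE j : c j = \sum_i u ord0 i * ((i == j)%:R * lam - A i j).
  under eq_bigr do rewrite mulrBr.
  rewrite sumrB; congr (_ - _); rewrite (bigD1 j)//= eqxx mul1r big1 ?addr0 1?mulrC//.
  by move=> i /negbTE ->; rewrite mul0r mulr0.
have c_lift j : j != ord0 -> c j = 0.
  by move=> j0; rewrite cE; have := uFj j; rewrite (negbTE j0).
(* The equation of column 0 was lost when that column became [v]; it is recovered from
   [\sum_j c j * v j = 0], a consequence of [A v = lam v]. *)
have c0 : c ord0 = 0.
  have : \sum_j c j * v j = 0.
    under eq_bigr do rewrite mulrBl mulr_suml.
    rewrite sumrB exchange_big/=.
    under [X in _ - X]eq_bigr => i _.
      under eq_bigr do rewrite -mulrA.
      rewrite -mulr_sumr Av mulrCA mulrA; over.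
    by rewrite subrr.
  rewrite (bigD1 ord0)//= big1 ?addr0; last first.
    by move=> j j0; rewrite c_lift ?mul0r.
  by move/eqP; rewrite mulf_eq0 (gt_eqF (v_gt0 _)) orbF => /eqP.
move/eqP: uv; apply/negP; apply: left_eigenvector_not_orthogonal => [|j].
  apply/existsP; apply: contra_neqT u0; rewrite negb_exists => /forallP uz.
  by apply/rowP => j; rewrite mxE; apply/eqP; rewrite -[_ == _]negbK.
apply/esym/eqP; rewrite -subr_eq0 -/(c j); apply/eqP.
by have [->|/c_lift] := eqVneq j ord0.
Qed.

End PositiveEigenvector.

(** * Cyclic sums of a positive kernel *)

Lemma cvg_ln_geometric_bounds (R : realType) (c C lam : R) (Z : nat -> R) :
  0 < c -> 0 < C -> 0 < lam ->
  (forall n, c * lam ^+ n <= Z n <= C * lam ^+ n) ->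
  (fun n => ln (Z n) / (4 * n.+1)%:R) @ \oo --> ln lam / 4.
Proof.
move=> c0 C0 lam0 bounds.
(* The exponent of [lam] is [n] but the layers number [n + 1]; the excess
   [(ln a - ln lam) / (4 (n + 1))] is a multiple of [harmonic n]. *)
have aux a : (fun n => ln lam / 4 + (ln a - ln lam) / 4 * harmonic n) @ \oo -->
    ln lam / 4.
  rewrite -[X in _ --> X]addr0; apply: cvgD; first exact: cvg_cst.
  rewrite -(mulr0 ((ln a - ln lam) / 4)); apply: cvgM; first exact: cvg_cst.
  exact: cvg_harmonic.
have auxE a n : 0 < a -> ln lam / 4 + (ln a - ln lam) / 4 * harmonic n =
    ln (a * lam ^+ n) / (4 * n.+1)%:R.
  move=> a0; rewrite lnM ?posrE ?exprn_gt0// lnXn// -mulr_natr.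
  rewrite /harmonic/= natrM -natr1; field.
  by rewrite addrC natr1 pnatr_eq0.
apply: squeeze_cvgr (aux c) (aux C); apply: nearW => n.
have [cZ ZC] := andP (bounds n).
have lamn : 0 < lam ^+ n by rewrite exprn_gt0.
have Z0 : 0 < Z n by apply: lt_le_trans cZ; rewrite mulr_gt0.
by rewrite !auxE// !ler_pM2r ?invr_gt0 ?ltr0n// !ler_ln ?posrE ?mulr_gt0// cZ.
Qed.

Section CyclicSum.
Variables (R : realType) (S : finType) (K : S -> S -> R) (V : S -> R) (lam : R).
Hypotheses (K_gt0 : forall x y, 0 < K x y) (V_gt0 : forall x, 0 < V x).
Hypothesis KV : forall x, \sum_y K x y * V y = lam * V x.

(** Open chain of [n + 1] states with [n] bonds. Going through [inord] lets the same naturals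
    address chains of different lengths. *)
Let path_weight n (s : {ffun 'I_n.+1 -> S}) :=
  \prod_(i < n) K (s (inord i)) (s (inord i.+1)).

Let path_sum n := \sum_(s : {ffun 'I_n.+1 -> S}) path_weight n s * V (s ord_max).

Let ffun_rcons n (p : {ffun 'I_n.+1 -> S} * S) : {ffun 'I_n.+2 -> S} :=
  [ffun i => if unlift ord_max i is Some j then p.1 j else p.2].

Let ffun_rcons_bij n : bijective (@ffun_rcons n).
Proof.
exists (fun s : {ffun 'I_n.+2 -> S} =>
  ([ffun i : 'I_n.+1 => s (lift ord_max i)], s ord_max)) => [[s x]|s].
  congr (_, _); last by rewrite ffunE unlift_none.
  by apply/ffunP => i; rewrite !ffunE liftK.
by apply/ffunP => i; rewrite !ffunE; case: unliftP => [j|] -> //=; rewrite ffunE.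
Qed.

Let ffun_rcons_max n p : ffun_rcons n p ord_max = p.2.
Proof. by rewrite ffunE unlift_none. Qed.

Let ffun_rcons_inord n p i : (i <= n)%N ->
  ffun_rcons n p (inord i) = p.1 (inord i).
Proof.
move=> le_in; rewrite (_ : inord i = lift ord_max (inord i)) ?ffunE ?liftK//.
apply: ord_inj; rewrite lift_max !inordK ?ltnS//; exact: leqW.
Qed.

(** Summing out the last state of the chain applies [K] to [V], which yields the factor [lam]. *)
Let path_sumS n : path_sum n.+1 = lam * path_sum n.
Proof.
rewrite /path_sum (reindex (ffun_rcons n)) /=; last first.
  exact/onW_bij/ffun_rcons_bij.
transitivity (\sum_(s : {ffun 'I_n.+1 -> S}) \sum_(x : S)
    path_weight n.+1 (ffun_rcons n (s, x)) * V (ffun_rcons n (s, x) ord_max)).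
  by rewrite [RHS]pair_bigA/=; apply: eq_bigr => -[].
rewrite mulr_sumr; apply: eq_bigr => s _.
rewrite mulrCA -KV mulr_sumr; apply: eq_bigr => x _.
rewrite ffun_rcons_max mulrA; congr (_ * _).
rewrite /path_weight big_ord_recr/=; congr (_ * _).
  by apply: eq_bigr => i _; rewrite !ffun_rcons_inord//= ltnW.
have inord_max m : inord m = ord_max :> 'I_m.+1 by apply: ord_inj; rewrite inordK.
by rewrite ffun_rcons_inord// (inord_max n) (inord_max n.+1) ffun_rcons_max.
Qed.

Let path_sumE n : path_sum n = lam ^+ n * path_sum 0.
Proof. by elim: n => [|n IH]; rewrite ?mul1r// path_sumS IH exprS mulrA. Qed.

(* The closing factor K (s n) (s 0) is comparable to V (s n), and the open
   path sum weighted by V is exactly geometric. *)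
Lemma cyclic_sum_geometric_bounds (x0 : S) :
  exists c C, [/\ 0 < c, 0 < C & forall n, c * lam ^+ n <=
    \sum_(s : {ffun 'I_n.+1 -> S}) \prod_(m < n.+1) K (s m) (s (ordS m))
    <= C * lam ^+ n].
Proof.
have weight_gt0 n s : 0 < path_weight n s by apply: prodr_gt0 => i _.
have sum0_gt0 : 0 < path_sum 0.
  rewrite /path_sum (bigD1 [ffun=> x0])//= ltr_pwDl ?mulr_gt0//.
  by rewrite sumr_ge0// => s _; rewrite ltW// mulr_gt0.
(* By finiteness, [c * V x <= K x y <= d^-1 * V x] for all [x] and [y]. *)
have [c c0 cK] := @lower_bound_gt0 R (S * S)%type (fun p => K p.1 p.2 / V p.1)
  (fun p => divr_gt0 (K_gt0 _ _) (V_gt0 _)).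
have [d d0 dK] := @lower_bound_gt0 R (S * S)%type (fun p => V p.1 / K p.1 p.2)
  (fun p => divr_gt0 (V_gt0 _) (K_gt0 _ _)).
exists (c * path_sum 0), (d^-1 * path_sum 0); split.
- by rewrite mulr_gt0.
- by rewrite mulr_gt0// invr_gt0.
move=> n; rewrite -!mulrA ![path_sum 0 * _]mulrC -path_sumE /path_sum !mulr_sumr.
have prodE (s : {ffun 'I_n.+1 -> S}) : \prod_(m < n.+1) K (s m) (s (ordS m)) =
    path_weight n s * K (s ord_max) (s ord0).
  rewrite big_ord_recr/=; congr (_ * K _ (s _)).
    apply: eq_bigr => i _; congr (K (s _) (s _)); apply: val_inj => /=.
      by rewrite inordK// ltnW// ltnS.
    by rewrite inordK ?modn_small ?ltnS.
  by apply: val_inj; rewrite /= modnn.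
apply/andP; split; apply: ler_sum => s _; rewrite prodE mulrCA ler_pM2l//.
- by have := cK (s ord_max, s ord0); rewrite /= ler_pdivlMr.
- have := dK (s ord_max, s ord0); rewrite /= ler_pdivlMr// => dKV.
  by rewrite mulrC ler_pdivlMr// mulrC.
Qed.

End CyclicSum.

(** * Symmetries of the cube and the quotient matrix *)

Section CubeSymmetries.
Variable (R : realType) (J : 'I_(size Phi) -> R).

Lemma eq_Hcube sa sb sa' sb' :
  (forall i, (i < 4)%N -> sa i = sa' i) -> (forall i, (i < 4)%N -> sb i = sb' i) ->
  Hcube J sa sb = Hcube J sa' sb'.
Proof.
move=> ea eb; rewrite /Hcube; congr (- _).
apply: eq_bigr => j _; congr (_ * _); apply: eq_bigr => r _.
by apply: eq_bigr => p _; rewrite ea ?eb ?ltn_mod.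
Qed.

(** Rotating both layers replaces [r] by [r + 1], so the four terms of the sum over [r] are permuted
    cyclically. *)
Lemma Hcube_rot sa sb :
  Hcube J (fun i => sa (i.+1 %% 4)%N) (fun i => sb (i.+1 %% 4)%N) = Hcube J sa sb.
Proof.
rewrite /Hcube; congr (- _); apply: eq_bigr => j _; congr (_ * _).
have rotE r : rot_prod R (fun i => sa (i.+1 %% 4)%N) (fun i => sb (i.+1 %% 4)%N)
    (nth [::] Phi j) r = rot_prod R sa sb (nth [::] Phi j) r.+1.
  by apply: eq_bigr => p _; rewrite -addn1 modnDml addn1 -addnS.
under eq_bigr do rewrite rotE.
rewrite big_ord_recr/= [RHS]big_ord_recl/= addrC; congr (_ + _).
by apply: eq_bigr => p _; rewrite addn0 modnDr.
Qed.

Lemma Hcube_flip sa sb :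
  Hcube J (fun i => ~~ sa i) (fun i => ~~ sb i) = Hcube J sa sb.
Proof.
rewrite /Hcube; congr (- _); apply: eq_bigr => j _; congr (_ * _).
apply: eq_bigr => r _; rewrite /rot_prod.
under eq_bigr => p _.
  rewrite (_ : spin _ _ = -1 * spin R (if p.1 == 0%N then sa ((p.2 + r) %% 4)%N
                                    else sb ((p.2 + r) %% 4)%N)); last first.
    by case: ifP => _; rewrite /spin; case: (_ (_ %% 4)%N); rewrite !mulN1r ?opprK.
  over.
rewrite big_split/=.
(* A flip multiplies each product by -1 to the size of its support; evenness of all sizes in [Phi]
   is checked by computation. *)
have /all_nthP := (erefl : all (fun s => ~~ odd (size s)) Phi).
move=> /(_ [::] j (ltn_ord j)) even_j.
by rewrite big_const_seq count_predT iter_mulr_1 -signr_odd (negbTE even_j) mul1r.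
Qed.

End CubeSymmetries.

Section Lumping.
Variables (R : realType) (kB : R) (J : 'I_(size Phi) -> R) (T : R).

Let S4 := {ffun 'I_4 -> bool}.

Definition boltzmann (x y : {ffun 'I_4 -> bool}) : R :=
  expR (- Hcube J (fun i => x (inord i)) (fun i => y (inord i)) / (kB * T)).

Lemma Zpart_boltzmann M : Zpart kB J M T =
  \sum_(s : {ffun 'I_M -> S4}) \prod_(m < M) boltzmann (s m) (s (ordS m)).
Proof.
apply: eq_bigr => s _; rewrite -expR_sum; congr expR.
by rewrite -mulr_suml sumrN.
Qed.

(** On the four bits of [k - 1], [index_rot] moves the lowest bit to the top, and [index_flip] is
    the complement, since [(17 - k) - 1 = 15 - (k - 1)]. *)
Let index_rot k := ((k.-1)./2 + 8 * odd k.-1).+1%N.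
Let index_flip k := (17 - k)%N.

Let in_range k := k \in index_iota 1 17.

Let index_rot_range k : in_range k -> in_range (index_rot k).
Proof. by move: k; apply/allP. Qed.

Let index_flip_range k : in_range k -> in_range (index_flip k).
Proof. by move: k; apply/allP. Qed.

Let state_rot k i : in_range k -> (i < 4)%N ->
  state_of_index (index_rot k) i = state_of_index k (i.+1 %% 4)%N.
Proof.
move=> kr i4; have i4' : i \in iota 0 4 by rewrite mem_iota.
have /allP/(_ k kr)/allP/(_ i i4')/eqP := (erefl : all (fun k => all (fun i =>
  state_of_index (index_rot k) i == state_of_index k (i.+1 %% 4)%N) (iota 0 4)) (index_iota 1 17)).
by [].
Qed.

Let state_flip k i : in_range k -> (i < 4)%N ->
  state_of_index (index_flip k) i = ~~ state_of_index k i.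
Proof.
move=> kr i4; have i4' : i \in iota 0 4 by rewrite mem_iota.
have /allP/(_ k kr)/allP/(_ i i4')/eqP := (erefl : all (fun k => all (fun i =>
  state_of_index (index_flip k) i == ~~ state_of_index k i) (iota 0 4)) (index_iota 1 17)).
by [].
Qed.

Let theta_rot k l : in_range k -> in_range l ->
  theta_entry kB J T (index_rot k) (index_rot l) = theta_entry kB J T k l.
Proof.
move=> kr lr; rewrite /theta_entry -(Hcube_rot _ J (state_of_index k)).
by rewrite (@eq_Hcube _ _ _ _ _ _ (fun i => @state_rot k i kr) (fun i => @state_rot l i lr)).
Qed.

Let theta_flip k l : in_range k -> in_range l ->
  theta_entry kB J T (index_flip k) (index_flip l) = theta_entry kB J T k l.
Proof.
move=> kr lr; rewrite /theta_entry -(Hcube_flip _ J (state_of_index k)).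
by rewrite (@eq_Hcube _ _ _ _ _ _ (fun i => @state_flip k i kr) (fun i => @state_flip l i lr)).
Qed.

Let row_sum (j : 'I_4) k :=
  \sum_(1 <= l < 17 | l \in nth [::] groups j) theta_entry kB J T k l.

(** A map that preserves [theta] and permutes each group can be used to reindex the row sum. *)
Let row_sum_invariant (h : nat -> nat) :
  (forall k, in_range k -> in_range (h k)) ->
  (forall k l, in_range k -> in_range l ->
     theta_entry kB J T (h k) (h l) = theta_entry kB J T k l) ->
  (forall j, j \in iota 0 4 -> let G := [seq l <- index_iota 1 17 | l \in nth [::] groups j] in
     perm_eq (map h G) G) ->
  forall j k, in_range k -> row_sum j (h k) = row_sum j k.
Proof.
move=> hr htheta hG j k kr.
pose G := [seq l <- index_iota 1 17 | l \in nth [::] groups j].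
have Gp : perm_eq (map h G) G by apply: hG; rewrite mem_iota/=.
have Gr l : l \in G -> in_range l by rewrite mem_filter => /andP[].
have GE m : row_sum j m = \sum_(l <- G) theta_entry kB J T m l by rewrite big_filter.
rewrite !GE; move: G Gp Gr {GE} => G Gp Gr.
rewrite -(perm_big _ Gp) big_map big_seq [RHS]big_seq; apply: eq_bigr => l lG.
by rewrite htheta// Gr.
Qed.

Let row_sum_rot j k : in_range k -> row_sum j (index_rot k) = row_sum j k.
Proof.
apply: row_sum_invariant; [exact: index_rot_range|exact: theta_rot|].
by apply/allP.
Qed.

Let row_sum_flip j k : in_range k -> row_sum j (index_flip k) = row_sum j k.
Proof.
apply: row_sum_invariant; [exact: index_flip_range|exact: theta_flip|].
by apply/allP.
Qed.

Let orbit k := find (fun G => k \in G) groups.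

(** The lumpability condition: [tau], computed at one representative per group, records the row sums
    of every member of the group. *)
Let row_sum_orbit j k : in_range k -> row_sum j k = row_sum j (nth 0%N reps (orbit k)).
Proof.
move=> kr; set r := nth _ _ _.
have iter_range a l : in_range l -> in_range (iter a index_rot l).
  by move=> lr; elim: a => //= a IH; exact: index_rot_range.
have row_iter a l : in_range l -> row_sum j (iter a index_rot l) = row_sum j l.
  by move=> lr; elim: a => //= a IH; rewrite row_sum_rot// iter_range.
have rr : in_range r.
  have /allP/(_ k kr) := (erefl : all (fun k =>
    nth 0%N reps (find (fun G => k \in G) groups) \in index_iota 1 17) (index_iota 1 17)).
  by [].
(* Every index comes from its representative by rotations, possibly after one flip; this is checked
   on all 16 indices. *)
have /allP/(_ k kr)/hasP[a _ /orP[]/eqP e] := (erefl : all (fun k =>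
   has (fun a => (k == iter a index_rot (nth 0%N reps (orbit k))) ||
      (k == iter a index_rot (index_flip (nth 0%N reps (orbit k))))) (iota 0 4)) (index_iota 1 17)).
- by rewrite e row_iter.
- by rewrite e row_iter ?row_sum_flip// index_flip_range.
Qed.

Let decode (l : 'I_16) : S4 := [ffun i : 'I_4 => state_of_index l.+1 i].
Let encode (y : S4) : 'I_16 :=
  inord (y (inord 0) + 2 * y (inord 1) + 4 * y (inord 2) + 8 * y (inord 3)).

Let encodeK : cancel encode decode.
Proof.
move=> y; apply/ffunP => i; rewrite ffunE -[i in RHS]inord_val /encode inordK.
  case: i => -[|[|[|[|//]]]] i4 /=.
all: by case: (y (inord 0)); case: (y (inord 1)); case: (y (inord 2)); case: (y (inord 3)).
Qed.

Let decodeK : cancel decode encode.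
Proof.
move=> k; apply: ord_inj; rewrite /encode !ffunE !inordK//.
  by case: k => k k16 /=; do 16?[case: k k16 => [//|k] k16].
by case: k => k k16 /=; do 16?[case: k k16 => [//|k] k16].
Qed.

Let boltzmann_decode k l : boltzmann (decode k) (decode l) = theta_entry kB J T k.+1 l.+1.
Proof.
rewrite /boltzmann /theta_entry (@eq_Hcube _ _ _ _ (state_of_index k.+1) (state_of_index l.+1))//.
  by move=> i i4; rewrite ffunE inordK.
by move=> i i4; rewrite ffunE inordK.
Qed.

(** The lift of [v] is constant on each group, so applying the kernel to it splits into row sums
    over groups, which are entries of [tau]. *)
Lemma boltzmann_eigenvector (lam : R) (v : 'I_4 -> R) :
  (forall i, 0 < v i) ->
  (forall i, \sum_j tau kB J T i j * v j = lam * v i) ->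
  exists V : {ffun 'I_4 -> bool} -> R, (forall x, 0 < V x) /\
    forall x, \sum_y boltzmann x y * V y = lam * V x.
Proof.
move=> v0 tv; exists (fun y => v (inord (orbit (encode y).+1))); split => // x.
rewrite -(encodeK x); set k := encode x; rewrite !decodeK.
rewrite (reindex decode); last by apply: onW_bij; exists encode.
have kr : in_range k.+1 by rewrite /in_range mem_index_iota/= ltnS ltn_ord.
have orbit4 l : in_range l -> (orbit l < 4)%N.
  by move: l; apply/allP.
transitivity (\sum_(1 <= l < 17) theta_entry kB J T k.+1 l * v (inord (orbit l))).
  rewrite big_add1 big_mkord; apply: eq_bigr => l _.
  by rewrite boltzmann_decode decodeK.
rewrite (partition_big (fun l => inord (orbit l) : 'I_4) xpredT)//= -tv.
apply: eq_bigr => j _.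
have -> : tau kB J T (inord (orbit k.+1)) j = row_sum j k.+1.
  by rewrite mxE inordK ?orbit4// [RHS]row_sum_orbit.
rewrite /row_sum mulr_suml.
rewrite big_seq_cond [RHS]big_seq_cond; apply: eq_big => [l|l /andP[_ /eqP ->]//].
case lr : (l \in _) => //=; rewrite -val_eqE/= inordK ?orbit4//.
have j4 : val j \in iota 0 4 by rewrite mem_iota/=.
have /allP/(_ l lr)/allP/(_ _ j4)/eqP := (erefl : all (fun l => all (fun j =>
  (orbit l == j) == (l \in nth [::] groups j)) (iota 0 4)) (index_iota 1 17)).
by [].
Qed.

End Lumping.

(** * Twice derivable functions on the positive half-line *)

Section TwiceDerivable.
Variable R : realType.
Implicit Types f g : R -> R.

(** A witness [f1], constrained only for positive arguments, lets the closure lemmas use the usual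
    derivative formulas; [twice_derivableP] returns to [derive1]. *)
Definition twice_derivable f := exists f1 : R -> R, forall t : R, 0 < t ->
  is_derive t 1 f (f1 t) /\ derivable f1 t 1.

Lemma twice_derivableP f (t : R) : twice_derivable f -> 0 < t ->
  derivable f t 1 /\ derivable (derive1 f) t 1.
Proof.
move=> [f1 f1P] t0; split; first by have [[fd _] _] := f1P t t0; exact: fd.
apply: near_eq_derivable (f1P t t0).2.
near=> s; rewrite derive1E; apply/esym; apply: (@derive_val _ _ _ _ _ _ _ (f1P s _).1).
by near: s; exact: lt_nbhsr.
Unshelve. all: by end_near.
Qed.

Lemma twice_derivable_cst (c : R) : twice_derivable (fun=> c).
Proof.
exists (fun=> 0) => t _; split; first exact: is_derive_cst.
exact: derivable_cst.
Qed.

Lemma twice_derivableD f g : twice_derivable f -> twice_derivable g ->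
  twice_derivable (fun t => f t + g t).
Proof.
move=> [f1 f1P] [g1 g1P]; exists (fun t => f1 t + g1 t) => t t0.
have [fd f1d] := f1P t t0; have [gd g1d] := g1P t t0.
by split; [exact: is_deriveD|exact: derivableD].
Qed.

Lemma twice_derivableM f g : twice_derivable f -> twice_derivable g ->
  twice_derivable (fun t => f t * g t).
Proof.
move=> [f1 f1P] [g1 g1P]; exists (fun t => f t * g1 t + g t * f1 t) => t t0.
have [fd f1d] := f1P t t0; have [gd g1d] := g1P t t0.
split; first exact: is_deriveM.
have [fd' _] := fd; have [gd' _] := gd.
exact: derivableD (derivableM fd' g1d) (derivableM gd' f1d).
Qed.

Lemma twice_derivableN f : twice_derivable f -> twice_derivable (fun t => - f t).
Proof.
move=> [f1 f1P]; exists (fun t => - f1 t) => t t0.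
have [fd f1d] := f1P t t0.
by split; [exact: is_deriveN|exact: derivableN].
Qed.

Lemma twice_derivable_sum (I : Type) (r : seq I) (P : pred I) (F : I -> R -> R) :
  (forall i, twice_derivable (F i)) ->
  twice_derivable (fun t => \sum_(i <- r | P i) F i t).
Proof.
move=> FP; elim: r => [|i r IH].
  by under eq_fun do rewrite big_nil; exact: twice_derivable_cst.
under eq_fun do rewrite big_cons; case: (P i) => //.
exact: twice_derivableD.
Qed.

Lemma twice_derivable_expR_inv (c : R) : twice_derivable (fun t => expR (c * t^-1)).
Proof.
pose e t := expR (c * t^-1).
have inv_der (t : R) : 0 < t -> is_derive t 1 (fun s : R => s^-1) (- t ^- 2).
  move=> t0; apply: is_derive_eq.
    by apply: (@is_deriveV _ id); rewrite ?gt_eqF.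
  by rewrite /= -[LHS]mulrC mul1r.
have e_der (t : R) : 0 < t -> is_derive t 1 e (e t * (c * - t ^- 2)).
  move=> t0; apply: (@is_derive1_comp _ expR (fun s => c * s^-1)).
  by apply: is_deriveZ; exact: inv_der.
exists (fun t => e t * (c * - (t^-1 * t^-1))) => t t0; split.
  by rewrite -invfM; exact: e_der.
have [ed _] := e_der t t0; have [vd _] := inv_der t t0.
apply: derivableM ed _; apply: derivableM; first exact: derivable_cst.
exact: derivableN (derivableM vd vd).
Qed.

Definition coefs_twice_derivable (P : R -> {poly R}) :=
  forall k, twice_derivable (fun t => (P t)`_k).

Lemma coefs_twice_derivableM P Q : coefs_twice_derivable P -> coefs_twice_derivable Q ->
  coefs_twice_derivable (fun t => P t * Q t).
Proof.
move=> dP dQ k; under eq_fun do rewrite coefM.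
by apply: twice_derivable_sum => i; exact: twice_derivableM.
Qed.

(** The Leibniz expansion uses only sums and products of entries of [X - A t], whose coefficients
    are twice derivable. *)
Lemma coefs_twice_derivable_char_poly n (A : R -> 'M[R]_n) :
  (forall i j, twice_derivable (fun t => A t i j)) ->
  coefs_twice_derivable (fun t => char_poly (A t)).
Proof.
move=> dA k; rewrite /char_poly /determinant.
under eq_fun do rewrite coef_sum.
apply: twice_derivable_sum => s; move: k; apply: coefs_twice_derivableM.
  by move=> k; exact: twice_derivable_cst.
elim: (index_enum _) => [|i r IH] k.
  by under eq_fun do rewrite big_nil; exact: twice_derivable_cst.
under eq_fun do rewrite big_cons; move: k; apply: coefs_twice_derivableM => //.
move=> k; under eq_fun do rewrite !mxE coefB coefC.
apply: twice_derivableD; first exact: twice_derivable_cst.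
apply: twice_derivableN; case: (k == 0)%N => //; exact: twice_derivable_cst.
Qed.

End TwiceDerivable.

(** * Implicit differentiation of a simple root *)

Section ImplicitRoot.
Variables (R : realType) (P : R -> {poly R}) (n : nat) (x : R -> R).
Hypotheses (size_P : forall t, (size (P t) <= n)%N)
           (dP : coefs_twice_derivable R P)
           (Px : forall t : R, 0 < t -> root (P t) (x t))
           (x_simple : forall t : R, 0 < t -> (P t)^`().[x t] != 0)
           (x_cts : forall t : R, 0 < t -> x s @[s --> t] --> x t).

(** The implicit function formula: minus the derivative of [P] in [t] at fixed argument, over its
    derivative in the argument. *)
Let dx (t : R) := - (\sum_(k < n) derive1 (fun s => (P s)`_k) t * x t ^+ k) / (P t)^`().[x t].

(* With P t = Q * (X - x t), the identity P (t + h).[x (t + h)] = 0 reads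
   Q.[x (t + h)] * (x (t + h) - x t) = - (P (t + h) - P t).[x (t + h)],
   and Q.[x t] is the derivative of P t at x t. *)
Let is_derive_root (t : R) : 0 < t -> is_derive t 1 x (dx t).
Proof.
move=> t0; have /factor_theorem[Q PQ] := Px _ t0.
have Qx : Q.[x t] = (P t)^`().[x t].
  by rewrite PQ derivM derivXsubC !hornerE subrr mulr0 add0r.
have shift_cvg : h + t @[h --> 0^'] --> t.
  rewrite -[X in _ --> X]add0r; apply: cvgD; last exact: cvg_cst.
  exact: cvg_within.
(* The quotient [Q] and the coefficient differences are evaluated at the moving root, so continuity
   of [x] is what gives their limits. *)
have xh : x (h + t) @[h --> 0^'] --> x t by exact: cvg_comp shift_cvg (x_cts _ t0).
have Qh : Q.[x (h + t)] @[h --> 0^'] --> (P t)^`().[x t].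
  by rewrite -Qx; apply: cvg_comp xh _; exact: continuous_horner.
pose q k (h : R) := h^-1 * ((P (h + t))`_k - (P t)`_k).
have qh k : q k h @[h --> 0^'] --> derive1 (fun s => (P s)`_k) t.
  have [dk _] := twice_derivableP _ _ _ (dP k) t0.
  rewrite derive1E /derive (_ : q k = fun h =>
    h^-1 *: (((fun s => (P s)`_k) \o shift t) (h *: 1) - (P t)`_k)); first exact: dk.
  by apply/funext => h; rewrite /q /= [h *: 1]mulr1.
have lim_h : (- (\sum_(k < n) q k h * x (h + t) ^+ k) / Q.[x (h + t)])
    @[h --> 0^'] --> dx t.
  apply: cvgM; last by apply: cvgV => //; exact: x_simple.
  apply: cvgN; apply: cvg_big => [|k _]; first exact: add_continuous.
  apply: cvgM; first exact: qh.
  exact: cvg_comp xh (@exprn_continuous _ k (x t)).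
have quot_h : h^-1 *: (x (h *: 1 + t) - x t) @[h --> 0^'] --> dx t.
  apply: cvg_trans lim_h; apply: near_eq_cvg; near=> h.
  have h0 : h != 0 by near: h; exact: nbhs_dnbhs_neq.
  have ht0 : 0 < h + t by near: h; exact: shift_cvg (lt_nbhsr t0).
  have Q0 : Q.[x (h + t)] != 0 by near: h; exact: cvgr_neq0 Qh (x_simple _ t0).
  have /rootP := Px _ ht0; rewrite (horner_coef_wide _ (size_P _)) => Ph.
  have PtE : (P t).[x (h + t)] = Q.[x (h + t)] * (x (h + t) - x t).
    by rewrite PQ !hornerE.
  rewrite (horner_coef_wide _ (size_P _)) in PtE.
  rewrite [h *: 1]mulr1 -[_ *: _]/(_ * _).
  apply: (mulIf Q0); rewrite mulfVK//.
  rewrite -mulrA [_ * Q.[_]]mulrC -PtE.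
  under eq_bigr do rewrite -mulrA mulrBl.
  by rewrite -mulr_sumr sumrB Ph sub0r mulrN opprK.
apply: DeriveDef; first exact: cvgP quot_h.
exact: cvg_lim quot_h.
Unshelve. all: by end_near.
Qed.

Let derivable_fsum (F : 'I_n -> R -> R) (t : R) :
  (forall k, derivable (F k) t 1) -> derivable (fun s => \sum_(k < n) F k s) t 1.
Proof. by move=> dF; rewrite -(fct_sumE _ _ F); exact: derivable_sum. Qed.

(** Once [x] is derivable, [dx] is a quotient of derivable functions: its ingredients are powers of
    [x], the coefficients and their first derivatives. *)
Lemma twice_derivable_root : twice_derivable R x.
Proof.
exists dx => t t0; split; first exact: is_derive_root.
have [xd _] := is_derive_root t t0.
have xkd k : derivable (fun s => x s ^+ k) t 1.
  elim: k => [|k IH]; first exact: derivable_cst.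
  by under eq_fun do rewrite exprS; exact: derivableM xd IH.
have [numd dend] : derivable (fun s => - \sum_(k < n)
      derive1 (fun s => (P s)`_k) s * x s ^+ k) t 1 /\
    derivable (fun s => (P s)^`().[x s]) t 1.
  split.
    apply: derivableN; apply: derivable_fsum => k.
    exact: derivableM (twice_derivableP _ _ _ (dP k) t0).2 (xkd k).
  rewrite (_ : (fun s => _) =
      (fun s => \sum_(k < n) ((P s)`_k.+1 * k.+1%:R * x s ^+ k))); last first.
    apply/funext => s; rewrite (@horner_coef_wide _ n).
      by apply: eq_bigr => k _; rewrite coef_deriv mulr_natr.
    have [->|P0] := eqVneq (P s) 0; first by rewrite deriv0 size_poly0.
    exact: leq_trans (ltnW (lt_size_deriv P0)) (size_P s).
  apply: derivable_fsum => k.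
  have [ck _] := twice_derivableP _ _ _ (dP k.+1) t0.
  exact: derivableM (derivableM ck (derivable_cst _ _ _)) (xkd k).
have invd : derivable (fun s => ((P s)^`().[x s])^-1) t 1.
  by apply: derivableV; [exact: x_simple|exact: dend].
exact: derivableM numd invd.
Qed.

End ImplicitRoot.

(** * Thermodynamics *)

Lemma exists_largest_root_char_poly (R : realType) n (A : 'M[R]_n.+1) :
  (forall i j, 0 < A i j) -> exists lam, is_largest_real_root (char_poly A) lam.
Proof.
move=> A0; have [lam [v [_ v0 Av _]]] := Perron R n A A0; exists lam; split.
  exact: root_char_poly_eigenvector v0 _ Av.
by move=> y; apply: (root_char_poly_le _ _ _ v) => // i; rewrite Av.
Qed.

(** The given root is the Perron value: maximality of [lam] gives one inequality and
    [root_char_poly_le] the other. *)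
Lemma Perron_largest_root (R : realType) n (A : 'M[R]_n.+1) lam :
  (forall i j, 0 < A i j) -> is_largest_real_root (char_poly A) lam ->
  exists v : 'I_n.+1 -> R,
  [/\ 0 < lam, forall i, 0 < v i, forall i, \sum_j A i j * v j = lam * v i &
      forall mu (u : 'I_n.+1 -> R), (forall j, 0 <= u j) -> 0 < \sum_j u j ->
        (forall i, mu * u i <= \sum_j A i j * u j) -> mu <= lam].
Proof.
move=> A0 [rlam lam_max]; have [mu [v [mu0 v0 Av mu_max]]] := Perron R n A A0.
suff -> : lam = mu by exists v.
apply/eqP; rewrite eq_le lam_max ?(root_char_poly_eigenvector _ _ _ v)// andbT.
by apply: (root_char_poly_le _ _ _ v) rlam => // i; rewrite Av.
Qed.

(* The Perron vector at T gives Collatz-Wielandt bounds from both sides for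
   the nearby matrices. *)
Lemma largest_root_continuous (R : realType) n (A : R -> 'M[R]_n.+1) (lam : R -> R) (T : R) :
  (forall t i j, 0 < A t i j) ->
  (forall i j, A t i j @[t --> T] --> A T i j) ->
  (forall t, 0 < t -> is_largest_real_root (char_poly (A t)) (lam t)) ->
  0 < T -> lam t @[t --> T] --> lam T.
Proof.
move=> A0 A_cts lamP T0.
have [v [lam0 v0 Av _]] := Perron_largest_root _ _ _ _ (A0 T) (lamP T T0).
have Av_cts i : \sum_j A t i j * v j @[t --> T] --> lam T * v i.
  rewrite -Av; apply: cvg_big => [|j _]; first exact: add_continuous.
  by apply: cvgM; [exact: A_cts|exact: cvg_cst].
apply/cvgrPdist_le => e e0.
(* The vector [v] is kept fixed; finitely many strict inequalities that hold in the limit persist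
   near [T]. *)
have upper : \forall t \near T, forall i, \sum_j A t i j * v j < (lam T + e) * v i.
  apply: (@filter_forall _ _ (fun i t => \sum_j A t i j * v j < (lam T + e) * v i) (nbhs T) _) => i.
  apply: cvgr_lt (Av_cts i) _ _.
  by rewrite mulrDl ltrDl mulr_gt0.
have lower : \forall t \near T, forall i, (lam T - e) * v i < \sum_j A t i j * v j.
  apply: (@filter_forall _ _ (fun i t => (lam T - e) * v i < \sum_j A t i j * v j) (nbhs T) _) => i.
  apply: cvgr_gt (Av_cts i) _ _.
  by rewrite mulrBl gtrBl mulr_gt0.
near=> t.
have t0 : 0 < t by near: t; exact: lt_nbhsr.
have [rt _] := lamP t t0.
have [_ [_ _ _ lam_max]] := Perron_largest_root _ _ _ _ (A0 t) (lamP t t0).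
have ub : lam t <= lam T + e.
  apply: (root_char_poly_le _ _ (A t) v) rt => // i.
  by apply: ltW; move: i; near: t.
have lb : lam T - e <= lam t.
  apply: (lam_max _ v) => [j||i]; first exact: ltW.
    by rewrite (bigD1 ord0)//= ltr_pwDl// sumr_ge0// => j _; exact: ltW.
  by apply: ltW; move: i; near: t.
by rewrite ler_distlC; lra.
Unshelve. all: by end_near.
Qed.

Section Model.
Variables (R : realType) (kB : R) (J : 'I_(size Phi) -> R).

Lemma tau_gt0 (T : R) i j : 0 < tau kB J T i j.
Proof.
rewrite mxE lt_neqAle eq_sym sumr_ge0 ?andbT; last by move=> l _; exact: expR_ge0.
rewrite psumr_neq0; last by move=> l _; exact: expR_ge0.
under eq_has do rewrite expR_gt0 andbT.
(* All terms are exponentials, so it remains to see that each of the four groups is nonempty. *)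
by case: j => -[|[|[|[|//]]]].
Qed.

Lemma twice_derivable_tau i j : twice_derivable R (fun t => tau kB J t i j).
Proof.
under eq_fun do rewrite mxE.
apply: twice_derivable_sum => l; rewrite /theta_entry.
under eq_fun do rewrite invfM mulrA.
exact: twice_derivable_expR_inv.
Qed.

Variable lam : R -> R.
Hypothesis lamP :
  forall T : R, 0 < T -> is_largest_real_root (char_poly (tau kB J T)) (lam T).

Lemma cvg_ln_Zpart (T : R) : 0 < T ->
  (fun n : nat => ln (Zpart kB J n.+1 T) / (4 * n.+1)%:R) @ \oo --> ln (lam T) / 4.
Proof.
move=> T0.
have [v [lam0 v0 tv _]] := Perron_largest_root _ _ _ _ (tau_gt0 T) (lamP T T0).
have [V [V0 KV]] := boltzmann_eigenvector _ _ _ _ _ _ v0 tv.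
have K0 x y : 0 < boltzmann R kB J T x y by exact: expR_gt0.
have [c [C [c0 C0 bounds]]] :=
  cyclic_sum_geometric_bounds _ _ _ _ _ K0 V0 KV [ffun=> false].
apply: cvg_ln_geometric_bounds c0 C0 lam0 _ => n.
by rewrite Zpart_boltzmann.
Qed.

Lemma twice_derivable_lam : twice_derivable R lam.
Proof.
(* The characteristic polynomial is a quartic, hence has size 5. *)
apply: (twice_derivable_root _ (fun t => char_poly (tau kB J t)) 5).
- by move=> t; rewrite size_char_poly.
- by apply: coefs_twice_derivable_char_poly => i j; exact: twice_derivable_tau.
- by move=> t t0; exact: (lamP t t0).1.
- move=> t t0.
  have [v [_ v0 tv _]] := Perron_largest_root _ _ _ _ (tau_gt0 t) (lamP t t0).
  exact: char_poly_deriv_eigenvector_neq0 (tau_gt0 t) v0 _ tv.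
- move=> t t0; apply: largest_root_continuous _ _ lamP (t0) => [s i j|i j].
    exact: tau_gt0.
  have [d _] := twice_derivableP _ _ _ (twice_derivable_tau i j) t0.
  apply: (@differentiable_continuous _ _ _ t (fun t => tau kB J t i j)).
  exact/derivable1_diffP.
Qed.

Lemma lam_gt0 (T : R) : 0 < T -> 0 < lam T.
Proof.
by move=> T0; have [v []] := Perron_largest_root _ _ _ _ (tau_gt0 T) (lamP T T0).
Qed.

Lemma twice_derivable_ln_lam : twice_derivable R (fun t => ln (lam t) / 4).
Proof.
have [l1 l1P] := twice_derivable_lam.
apply: twice_derivableM; last exact: twice_derivable_cst.
exists (fun t => (lam t)^-1 * l1 t) => t t0; have [ld l1d] := l1P t t0.
split.
  apply: (@is_derive1_comp _ (@ln R) lam) ld.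
  by apply: is_derive1_ln; exact: lam_gt0.
have [ld' _] := ld.
have lv : derivable (fun t => (lam t)^-1) t 1.
  by apply: derivableV; [rewrite gt_eqF// lam_gt0|exact: ld'].
exact: derivableM lv l1d.
Qed.

Lemma free_energyE (T : R) : 0 < T ->
  free_energy kB J T = - (kB * T / 4) * ln (lam T).
Proof.
move=> T0; rewrite /free_energy (cvg_lim _ (cvg_ln_Zpart _ T0))//.
by rewrite !mulNr mulrA [in RHS]mulrAC.
Qed.

Let g (t : R) := ln (lam t) / 4.

Lemma internal_energyE (T : R) : 0 < T ->
  internal_energy kB J T = kB * T ^+ 2 * derive1 g T.
Proof.
move=> T0; have [gd _] := twice_derivableP _ _ _ twice_derivable_ln_lam T0.
rewrite /internal_energy derive1E.
(* For [t > 0], hence near [T], the factor [t] cancels and [free_energy kB J t / t = - kB * g t]. *)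
rewrite (@near_eq_derive _ _ _ _ (fun t => (- kB) *: g t)); last first.
  near=> t; have t0 : 0 < t by near: t; exact: lt_nbhsr.
  rewrite free_energyE// /g -[RHS]/(_ * _); field.
  by rewrite gt_eqF.
rewrite (deriveZ _ gd) -derive1E -[_ *: _]/(_ * _).
ring.
Unshelve. all: by end_near.
Qed.

Lemma heat_capacityE (T : R) : 0 < T -> heat_capacity kB J T =
  2 * kB * T * derive1 g T + kB * T ^+ 2 * derive1 (derive1 g) T.
Proof.
move=> T0; have [_ gd] := twice_derivableP _ _ _ twice_derivable_ln_lam T0.
rewrite /heat_capacity derive1E.
rewrite (@near_eq_derive _ _ _ _ (fun t : R => (kB *: (t * t : R)) * derive1 g t)); last first.
  by near=> t; rewrite internal_energyE//; near: t; exact: lt_nbhsr.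
have sq : is_derive T 1 (fun t : R => kB *: (t * t : R)) (kB *: (T *: 1 + T *: 1)).
  by apply: is_deriveZ; exact: is_deriveM.
have gd' : is_derive T 1 (derive1 g) (derive1 (derive1 g) T).
  by apply: DeriveDef gd _; rewrite derive1E.
have := is_deriveM sq gd'.
move=> [_ ->]; rewrite -![_ *: _]/(_ * _); ring.
Unshelve. all: by end_near.
Qed.

End Model.

(** Existence of the largest root makes the second half nonvacuous. Convergence and derivability are
    asserted separately because [limn] and [derive1] take default values where the limit does not
    exist. *)
Theorem theorem1 (R : realType) (kB : R) (J : 'I_(size Phi) -> R) :
  0 < kB ->
  (forall T : R, 0 < T -> exists x : R, is_largest_real_root (char_poly (tau kB J T)) x) /\
  (forall lam : R -> R,
     (forall T : R, 0 < T -> is_largest_real_root (char_poly (tau kB J T)) (lam T)) ->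
     forall T : R, 0 < T ->
       let g := fun t : R => ln (lam t) / 4 in
       0 < lam T /\
       ((fun n : nat => ln (Zpart kB J n.+1 T) / (4 * n.+1)%:R) @ \oo --> g T) /\
       free_energy kB J T = - (kB * T / 4) * ln (lam T) /\
       derivable g T 1 /\ derivable (derive1 g) T 1 /\
       internal_energy kB J T = kB * T ^+ 2 * derive1 g T /\
       heat_capacity kB J T = 2 * kB * T * derive1 g T + kB * T ^+ 2 * derive1 (derive1 g) T).
Proof.
move=> _; split=> [T _|lam lamP T T0 g].
  by apply: exists_largest_root_char_poly => i j; exact: tau_gt0.
have [gd g1d] := twice_derivableP _ _ _ (twice_derivable_ln_lam _ _ _ _ lamP) T0.
split; first exact: lam_gt0 lamP _ T0.
split; first exact: cvg_ln_Zpart lamP _ T0.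
split; first exact: free_energyE lamP _ T0.
split; first exact: gd.
split; first exact: g1d.
split; first exact: internal_energyE lamP _ T0.
exact: heat_capacityE lamP _ T0.
Qed.
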